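(* Let $\beta>0$, $x=\tanh\beta$, and let $\sigma$ be distributed according to the Ising measure $\mathbb{I}_{0,\beta}$ on $\{1,\dots,n\}$. For every $r\ge1$ and indices $1\le i_1\le i_2\le\dots\le i_{2r}\le n$, $$\kappa(\sigma(i_1),\dots,\sigma(i_{2r}))=(-1)^{r-1}\sum_{\delta\in\mathfrak{D}^*_{2r}}\Big(\prod_{k=1}^{2r-1}\delta_k\Big)\,x^{\sum_{\{a<b\}\in\nu(\delta)}(i_b-i_a)}.$$
   Context: The Ising measure $\mathbb{I}_{0,\beta}$ gives to $\sigma:\{1,\dots,n\}\to\{\pm1\}$ probability proportional to $\exp(\beta\sum_{i=1}^{n-1}\sigma(i)\sigma(i+1))$. The joint cumulant is $\kappa(X_1,\dots,X_s)=\sum_{\Pi}(-1)^{\ell(\Pi)-1}(\ell(\Pi)-1)!\prod_{A\in\Pi}\mathbb{E}[\prod_{j\in A}X_j]$, the sum over set partitions $\Pi$ of $\{1,\dots,s\}$ with $\ell(\Pi)$ blocks. A Dyck path of length $2r$ is a sequence $\delta=(\delta_0,\dots,\delta_{2r})$ of nonnegative integers with $\delta_0=\delta_{2r}=0$ and $|\delta_{k+1}-\delta_k|=1$. $\mathfrak{D}^*_{2r}$ is the set of Dyck paths of length $2r$ with $\delta_k\ge1$ for all $1\le k\le2r-1$. For a Dyck path $\delta$, step $k$ (from $\delta_{k-1}$ to $\delta_k$) is up or down; $\nu(\delta)$ is the non-crossing pairing of $\{1,\dots,2r\}$ obtained by pairing each up step $a$ with the down step $b>a$ that first returns the path to level $\delta_{a-1}$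 (the usual matching). *)

(* Defs.v *)
From Stdlib Require Import Reals ZArith.
From mathcomp Require Import all_boot.
Set Implicit Arguments. Unset Strict Implicit. Unset Printing Implicit Defensive.

Open Scope R_scope.

Definition spin (s : seq bool) (j : nat) : R := if nth false s j then 1 else -1.

Definition ising_weight (n : nat) (beta : R) (sigma : n.-tuple bool) : R :=
  exp (beta * \big[Rplus/R0]_(k < n.-1) (spin sigma k * spin sigma k.+1)).

Definition ising_Z (n : nat) (beta : R) : R :=
  \big[Rplus/R0]_(sigma : n.-tuple bool) ising_weight beta sigma.

Definition ising_E (n : nat) (beta : R) (f : n.-tuple bool -> R) : R :=
  (\big[Rplus/R0]_(sigma : n.-tuple bool) (ising_weight beta sigma * f sigma))
  / ising_Z n beta.

(* joint cumulant of s random variables, given the mixed-moment map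
   A |-> E[prod_{j in A} X_j]; sum over set partitions P of {0..s-1} *)
Definition cumulant (s : nat) (mom : {set 'I_s} -> R) : R :=
  \big[Rplus/R0]_(P : {set {set 'I_s}} | partition P [set: 'I_s])
     ((-1) ^ (#|P| - 1) * INR (fact (#|P| - 1))
       * \big[Rmult/R1]_(A in P) mom A).

(* A lattice path is encoded by its step sequence (true = up, false = down);
   height after the first k steps: delta_k *)
Definition height (s : seq bool) (k : nat) : Z :=
  foldr (fun b z => ((if b then 1 else -1) + z)%Z) 0%Z (take k s).

(* s (of size 2r) is the step sequence of a Dyck path in D*_{2r}:
   delta_0 = 0 automatically, delta_{2r} = 0, and delta_k >= 1 for 1<=k<=2r-1
   (steps are +-1 by construction). *)
Definition dyckstar (s : seq bool) : bool :=
  Z.eqb (height s (size s)) 0 &&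
  [forall k : 'I_(size s), (0 < k)%N ==> Z.ltb 0 (height s k)].

(* 0-based step k goes from delta_k to delta_{k+1}.  For an up step k its
   partner in nu(delta) is the least step m > k with delta_{m+1} = delta_k. *)
Definition partner (s : seq bool) (k : nat) : nat :=
  k.+1 + find (fun d => Z.eqb (height s (k.+2 + d)) (height s k))
              (iota 0 (size s - k.+1)).

Definition pair_exponent (s : seq bool) (i : nat -> nat) : nat :=
  (\sum_(k < size s | nth false s k) (i (partner s k) - i k))%N.

(* Main.v *)
(* Grouping the set partitions by the numbers of blocks with odd trace on each
   initial segment {1..g} turns the moment products into powers of x attached to
   lattice paths: blocks that are all even give a path of heights delta_g with
   delta_{2r} = 0.  When the last element is removed from a partition with l >= 1
   blocks, o of which are odd, the weights (-1)^(l-1) (l-1)! of a new singleton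
   (factor -l), of an even block (l - o choices) and of an odd block (o choices)
   add up to o times (down step minus up step).  Hence the total weight of the
   partitions with a given path is the signed product of its heights, which
   vanishes as soon as the path returns to 0.  On the other side, the matching
   exponent counts, for every bond of the Ising chain, the up steps still open
   there, which is the height of the path. *)
From HB Require Import structures.
Require Import Defs.
From Stdlib Require Import Reals ZArith Lia Lra.
From mathcomp Require Import all_boot.
Set Implicit Arguments. Unset Strict Implicit. Unset Printing Implicit Defensive.
Open Scope R_scope.

(** * Adding an element to a set partition *)

HB.instance Definition _ := Monoid.isComLaw.Build R R0 Rplus
  (fun x y z => esym (Rplus_assoc x y z)) Rplus_comm Rplus_0_l.
HB.instance Definition _ := Monoid.isComLaw.Build R R1 Rmult
  (fun x y z => esym (Rmult_assoc x y z)) Rmult_comm Rmult_1_l.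
HB.instance Definition _ := Monoid.isMulLaw.Build R R0 Rmult Rmult_0_l Rmult_0_r.
HB.instance Definition _ := Monoid.isAddLaw.Build R Rmult Rplus
  Rmult_plus_distr_r Rmult_plus_distr_l.

Section PartitionInsert.
Variables (T : finType) (a : T).
Implicit Types (P : {set {set T}}) (B D E : {set T}).

(** The value [B = set0] stands for opening the new block [{a}], so the ways of adding [a] to [P]
    are indexed by [set0 |: P]. *)
Definition part_insert P B : {set {set T}} := (a |: B) |: (P :\ B).

(** Discarding [set0] covers the case where [a] is alone in its block: nothing of that block remains
    in the first component, and the second one, [set0], records the singleton. *)
Definition part_remove P : {set {set T}} * {set T} :=
  let C := pblock P a in ([set C :\ a] :\ set0 :|: P :\ C, C :\ a).

Lemma partition_setD1_set0 P D : partition P D -> P :\ set0 = P.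
Proof. by move=> pP; apply/setDidPl; rewrite disjoint_sym disjoints1 (partition0 pP). Qed.

Lemma sub_part_block P D B : partition P D -> B \in set0 |: P -> B \subset D.
Proof.
move=> pP; rewrite !inE => /orP[/eqP->|]; first exact: sub0set.
exact: (partitionS pP).
Qed.

Lemma partition_insert P D B : a \notin D -> partition P D -> B \in set0 |: P ->
  partition (part_insert P B) (a |: D).
Proof.
move=> aD pP BP; have sBD := sub_part_block pP BP.
have -> : a |: D = (a |: B) :|: (D :\: B).
  by rewrite -setUA -{1}(setID D B) (setIidPr sBD).
apply: partitionU1.
- move: BP; rewrite !inE => /orP[/eqP->|BP]; last exact: partitionD1.
  by rewrite (partition_setD1_set0 pP) setD0.
- by apply/set0Pn; exists a; rewrite setU11.
- rewrite -setI_eq0; apply/eqP/setP=> z; rewrite !inE.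
  by case: eqP => [->|_] /=; [rewrite (negbTE aD) andbF | case: (z \in B)].
Qed.

Lemma part_insert_notin P D B : a \notin D -> partition P D ->
  a |: B \notin P :\ B.
Proof.
move=> aD pP; apply/negP; rewrite !inE => /andP[_ /(partitionS pP)/subsetP/(_ a)].
by rewrite setU11 (negbTE aD) => /(_ isT).
Qed.

Lemma part_insertK P D B : a \notin D -> partition P D -> B \in set0 |: P ->
  part_remove (part_insert P B) = (P, B).
Proof.
move=> aD pP BP; have sBD := sub_part_block pP BP.
have aB : a \notin B by apply: contra aD; apply: (subsetP sBD).
have pI := partition_insert aD pP BP.
have -> : part_remove (part_insert P B)
  = let C := a |: B in ([set C :\ a] :\ set0 :|: part_insert P B :\ C, C :\ a).
  rewrite /part_remove (def_pblock (B := a |: B)) ?setU11 //.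
  exact: partition_trivIset pI.
rewrite /= /part_insert !setU1K // ?(part_insert_notin _ aD pP) //; congr pair.
move: BP; rewrite !inE => /orP[/eqP->|BP].
  by rewrite setDv set0U (partition_setD1_set0 pP).
have /setDidPl -> : [disjoint [set B] & [set set0]]; last by rewrite setD1K.
by rewrite disjoints1 inE (partition_neq0 pP BP).
Qed.

Lemma part_removeP P D P' B : a \notin D -> partition P (a |: D) ->
  part_remove P = (P', B) ->
  [/\ partition P' D, B \in set0 |: P' & part_insert P' B = P].
Proof.
move=> aD pP; rewrite /part_remove; set C := pblock P a => -[<- <-] {P' B}.
have acP : a \in cover P by rewrite (cover_partition pP) setU11.
have CP : C \in P by apply: pblock_mem.
have aC : a \in C by rewrite mem_pblock.
have sC : C \subset a |: D := partitionS pP CP.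
have pD := partitionD1 pP CP.
have eD : D = (C :\ a) :|: ((a |: D) :\: C).
  apply/setP=> z; rewrite !inE; case: eqP => [->|/eqP nz] /=.
    by rewrite aC (negbTE aD).
  case zC: (z \in C) => //=.
  by move/subsetP/(_ z zC): sC; rewrite !inE (negbTE nz).
have dC : [disjoint C :\ a & (a |: D) :\: C].
  rewrite -setI_eq0; apply/eqP/setP=> z; rewrite !inE.
  by case: (z \in C); rewrite ?andbF.
have insE Q : Q :\ (C :\ a) = P :\ C -> part_insert Q (C :\ a) = P.
  by rewrite /part_insert => ->; rewrite !setD1K.
have [C0|C0] := eqVneq (C :\ a) set0.
  rewrite C0 setDv set0U; split; last 2 first.
  - by rewrite setU11.
  - by rewrite -C0; apply: insE; rewrite C0 (partition_setD1_set0 pD).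
  by rewrite eD C0 set0U.
have /setDidPl -> : [disjoint [set C :\ a] & [set set0]].
  by rewrite disjoints1 inE.
have CnP : C :\ a \notin P :\ C.
  apply: contra C0 => CP'; rewrite -subset0; apply/subsetP=> z zC.
  have := partitionS pD CP'; move/subsetP/(_ z zC).
  by move: zC; rewrite !inE => /andP[_ ->].
split; last by apply: insE; rewrite setU1K.
- by rewrite eD; apply: partitionU1.
- by rewrite inE setU11 orbT.
Qed.

(** [part_insert] and [part_remove] are mutually inverse: a partition of [a |: D] is determined by
    its restriction to [D] and the rest of the block of [a]. *)
Lemma big_partition_insert (R : Type) (idx : R) (op : Monoid.com_law idx) D
    (F : {set {set T}} -> R) : a \notin D ->
  \big[op/idx]_(P | partition P (a |: D)) F P =
  \big[op/idx]_(P | partition P D) \big[op/idx]_(B in set0 |: P) F (part_insert P B).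
Proof.
move=> aD; rewrite pair_big_dep /=.
rewrite (reindex_onto (fun j => part_insert j.1 j.2) part_remove) /=; last first.
  by move=> P pP; have [_ _] := part_removeP aD pP (surjective_pairing _).
apply: eq_bigl => -[P B]; apply/andP/andP => [[pI /eqP eI]|[pP BP]].
  by have [] := part_removeP aD pI eI.
by rewrite partition_insert // (part_insertK aD pP BP).
Qed.

(** Keeping [F B] on the left avoids dividing by it. For empty [B] it is neutral, so joining a block
    and opening a singleton are treated alike. *)
Lemma big_part_insert (R : Type) (idx : R) (op : Monoid.com_law idx) P D B
    (F : {set T} -> R) : a \notin D -> partition P D -> B \in set0 |: P ->
  F set0 = idx ->
  op (F B) (\big[op/idx]_(C in part_insert P B) F C) =
  op (F (a |: B)) (\big[op/idx]_(C in P) F C).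
Proof.
move=> aD pP BP F0; rewrite big_setU1 ?(part_insert_notin _ aD pP) //=.
rewrite Monoid.mulmCA; congr (op _ _).
move: BP; rewrite !inE => /orP[/eqP->|BP]; last by rewrite [RHS](big_setD1 B).
by rewrite F0 Monoid.mul1m (partition_setD1_set0 pP).
Qed.

(** For an initial segment [E] this is the height, at the end of [E], of the lattice path attached
    to [P]. *)
Definition odd_blocks E P : nat := \sum_(B in P) odd #|B :&: E|.

Lemma odd_blocks_insert_notin E P D B : a \notin D -> a \notin E ->
  partition P D -> B \in set0 |: P ->
  odd_blocks E (part_insert P B) = odd_blocks E P.
Proof.
move=> aD aE pP BP.
have := big_part_insert addn (F := fun B => nat_of_bool (odd #|B :&: E|)) aD pP BP.
rewrite set0I cards0 /= => /(_ erefl) eI.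
apply/(@addnI (odd #|B :&: E|)); rewrite eI; congr (odd #|pred_of_set _| + _)%N.
apply/setP=> z; rewrite !inE; case: eqP => // ->.
by rewrite (negbTE aE) !andbF.
Qed.

Lemma odd_blocks_insert P D B : a \notin D ->
  partition P D -> B \in set0 |: P ->
  (odd #|B| + odd_blocks (a |: D) (part_insert P B) = ~~ odd #|B| + odd_blocks D P)%N.
Proof.
move=> aD pP BP.
have sB := sub_part_block pP BP.
have aB : a \notin B by apply: contra aD; apply: (subsetP sB).
have := big_part_insert addn
  (F := fun B => nat_of_bool (odd #|B :&: (a |: D)|)) aD pP BP.
rewrite set0I cards0 /= => /(_ erefl).
have -> : B :&: (a |: D) = B by apply/setIidPl; apply: subset_trans sB (subsetUr _ _).
have -> : (a |: B) :&: (a |: D) = a |: B by apply/setIidPl; apply: setUS.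
rewrite cardsU1 aB /= => ->; congr addn; apply: eq_bigr => C CP.
have sC := partitionS pP CP.
congr (nat_of_bool (odd #|pred_of_set _|)).
rewrite (setIidPl sC); apply/setIidPl; apply: subset_trans sC (subsetUr _ _).
Qed.

Lemma card_part_insert P D B : a \notin D ->
  partition P D -> B \in set0 |: P ->
  #|part_insert P B| = if B == set0 then #|P|.+1 else #|P|.
Proof.
move=> aD pP BP; rewrite cardsU1 (part_insert_notin _ aD pP).
case: eqP BP => [->|/eqP B0]; rewrite !inE.
  by rewrite (partition_setD1_set0 pP).
by rewrite (negbTE B0) /= => BP; rewrite [RHS](cardsD1 B) BP.
Qed.

End PartitionInsert.

(** * From set partitions to lattice paths *)

Lemma Rsum_const (T : finType) (A : {set T}) (c : R) :
  \big[Rplus/R0]_(i in A) c = INR #|A| * c.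
Proof.
rewrite big_const; elim: #|_| => [|m IH]; first by rewrite Rmult_0_l.
by rewrite [LHS]/= S_INR IH; lra.
Qed.

Lemma INR_sum (T : finType) (A : {pred T}) (F : T -> nat) :
  INR (\sum_(i in A) F i) = \big[Rplus/R0]_(i in A) INR (F i).
Proof. by apply: (big_morph INR) => // m p; rewrite plus_INR. Qed.

(** The Möbius function of the partition lattice from [P] up to the one-block partition. *)
Definition mobius_weight (T : finType) (P : {set {set T}}) : R :=
  (-1) ^ (#|P| - 1) * INR (fact (#|P| - 1)).

(* The contributions of the even blocks cancel against that of the new singleton,
   up to the number of odd blocks. *)
Lemma mobius_insert_sum (T : finType) (a : T) (D : {set T}) (P : {set {set T}})
    (G : nat -> R) (o := odd_blocks D P) :
  a \notin D -> partition P D -> P != set0 ->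
  \big[Rplus/R0]_(B in set0 |: P)
     (mobius_weight (part_insert a P B) * G (odd_blocks (a |: D) (part_insert a P B)))
  = mobius_weight P * (INR o * (G o.-1 - G o.+1)).
Proof.
move=> aD pP P0.
have P0F := partition0 pP.
rewrite big_setU1 ?P0F //=; set p := INR #|P|.
have -> : mobius_weight (part_insert a P set0) = - (p * mobius_weight P).
  rewrite /p /mobius_weight (card_part_insert aD pP) ?setU11 // eqxx.
  move: P0; rewrite -card_gt0; case: #|P| => // m _.
  rewrite !subSS !subn0 [fact m.+1]/= plus_INR mult_INR S_INR [_ ^ m.+1]/=; ring.
have -> : odd_blocks (a |: D) (part_insert a P set0) = o.+1.
  by have := odd_blocks_insert aD pP (setU11 _ _); rewrite cards0.
(* Joining an even block leads to [o.+1], an odd one to [o.-1]. Splitting off the constant [G o.+1]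
   gives [p] copies of it, which cancel the singleton term. *)
have -> : \big[Rplus/R0]_(B in P)
     (mobius_weight (part_insert a P B) * G (odd_blocks (a |: D) (part_insert a P B)))
  = \big[Rplus/R0]_(B in P) (mobius_weight P *
      (G o.+1 + INR (odd #|B :&: D|) * (G o.-1 - G o.+1))).
  apply: eq_bigr => B BP.
  have BP' : B \in set0 |: P by rewrite inE BP orbT.
  rewrite /mobius_weight (card_part_insert aD pP BP').
  rewrite (negbTE (partition_neq0 pP BP)).
  rewrite (setIidPl (partitionS pP BP)).
  have := odd_blocks_insert aD pP BP'; rewrite -/o.
  case: (odd _); rewrite !(add0n, add1n) => E; first by rewrite -E /=; ring.
  by rewrite E /=; ring.
rewrite -big_distrr big_split /= Rsum_const -[INR #|P|]/p -big_distrl /= -INR_sum.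
by rewrite -/(odd_blocks D P) -/o; ring.
Qed.

(** The common recursion: it acts on a functional of height sequences, so that one step of the
    partition sum and one step of the path sum become the same operation. *)
Definition history_step (H : seq Z -> R) (t : seq Z) : R :=
  IZR (last 0%Z t) * (H (rcons t (last 0 t - 1)%Z) - H (rcons t (last 0 t + 1)%Z)).

Section InitialSegments.
Variable N : nat.
Definition initial (k : nat) : {set 'I_N} := [set j : 'I_N | (j < k)%N].

Definition profile (k : nat) (P : {set {set 'I_N}}) : seq Z :=
  mkseq (fun g => Z.of_nat (odd_blocks (initial g) P)) k.+1.

Lemma initialS (k : nat) (kN : (k < N)%N) : initial k.+1 = Ordinal kN |: initial k.
Proof. by apply/setP=> j; rewrite !inE ltnS leq_eqVlt -val_eqE. Qed.

Lemma initial_notin (k g : nat) (kN : (k < N)%N) : (g <= k)%N -> Ordinal kN \notin initial g.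
Proof. by rewrite inE -leqNgt. Qed.

Lemma profile_insert (k : nat) (kN : (k < N)%N) (P : {set {set 'I_N}}) (B : {set 'I_N}) :
  partition P (initial k) -> B \in set0 |: P ->
  profile k.+1 (part_insert (Ordinal kN) P B) =
  rcons (profile k P)
    (Z.of_nat (odd_blocks (Ordinal kN |: initial k) (part_insert (Ordinal kN) P B))).
Proof.
move=> pP BP; rewrite /profile mkseqS -initialS; congr rcons.
apply/eq_in_map => g; rewrite mem_iota add0n ltnS => /= gk.
by rewrite (odd_blocks_insert_notin (initial_notin kN (leqnn k)) (initial_notin kN gk) pP BP).
Qed.

Lemma last_mkseq (T : Type) (x0 : T) (f : nat -> T) (k : nat) : last x0 (mkseq f k.+1) = f k.
Proof. by rewrite mkseqS last_rcons. Qed.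

Lemma mobius_profile_step (k : nat) (H : seq Z -> R) : (0 < k < N)%N ->
  \big[Rplus/R0]_(P | partition P (initial k.+1)) (mobius_weight P * H (profile k.+1 P)) =
  \big[Rplus/R0]_(P | partition P (initial k))
     (mobius_weight P * history_step H (profile k P)).
Proof.
case/andP=> k0 kN; rewrite (initialS kN) big_partition_insert ?initial_notin //.
apply: eq_bigr => P pP.
under eq_bigr => B BP do rewrite (profile_insert kN pP BP).
have P0 : P != set0.
  apply: contraTneq pP => ->; apply/negP => /cover_partition.
  rewrite /cover big_set0 => /setP/(_ (Ordinal (ltn_trans k0 kN))).
  by rewrite !inE /= k0.
rewrite (mobius_insert_sum (fun o => H (rcons (profile k P) (Z.of_nat o)))) ?initial_notin //.
rewrite /history_step last_mkseq -INR_IZR_INZ; congr (_ * _).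
(* At height 0 the truncated [o.-1] differs from the integer -1, but the factor 0 removes the term
   on both sides. *)
case: odd_blocks => [|o]; first by rewrite /= !Rmult_0_l.
by rewrite [_.-1]/= !Nat2Z.inj_succ Z.add_1_r Z.sub_1_r Z.pred_succ.
Qed.

End InitialSegments.

Lemma big_tuple_rcons (R : Type) (idx : R) (op : Monoid.com_law idx) (T : finType)
    (n : nat) (F : seq T -> R) :
  \big[op/idx]_(t : n.+1.-tuple T) F t =
  \big[op/idx]_(t : n.-tuple T) \big[op/idx]_(x : T) F (rcons t x).
Proof.
rewrite pair_bigA /=.
pose h (p : n.-tuple T * T) := [tuple of rcons p.1 p.2].
pose h' (t : n.+1.-tuple T) :=
  ([tuple of rev (behead (rev t))] : n.-tuple T, thead [tuple of rev t]).
rewrite (reindex_onto h h') /=.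
  apply: eq_big => [[t x]|[t x] _] //=; apply/eqP; rewrite /h' /h; congr pair.
    by apply: val_inj; rewrite /= rev_rcons /= revK.
  by rewrite /thead (tnth_nth x) /= rev_rcons.
move=> t _; apply: val_inj; rewrite /= -rev_cons.
rewrite -[RHS]revK; congr rev.
exact: esym (congr1 val (tuple_eta [tuple of rev t])).
Qed.

Definition step_sign (b : bool) : Z := (if b then 1 else -1)%Z.

Lemma height_rcons (s : seq bool) (b : bool) (j : nat) : (j <= size s)%N ->
  height (rcons s b) j = height s j.
Proof. by move=> js; rewrite /height -cats1 takel_cat. Qed.

Lemma heightS (s : seq bool) (k : nat) : (k < size s)%N ->
  height s k.+1 = (height s k + step_sign (nth false s k))%Z.
Proof.
move=> ks; rewrite /height (take_nth false ks) -cats1 foldr_cat /=.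
elim: (take k s) => [|c u IH] /=; first by rewrite /step_sign; lia.
by rewrite IH; lia.
Qed.

Definition heights (s : seq bool) : seq Z := mkseq (height s) (size s).+1.

(** The total Möbius weight of the partitions with a given profile. Only interior heights enter,
    since a height becomes a factor when the next step is taken. *)
Definition path_weight (s : seq bool) : R :=
  (-1) ^ (count_mem true s - 1) * \big[Rmult/R1]_(1 <= k < size s) IZR (height s k).

Lemma heights_rcons (s : seq bool) (b : bool) :
  heights (rcons s b) = rcons (heights s) (height s (size s) + step_sign b)%Z.
Proof.
rewrite /heights size_rcons mkseqS heightS ?size_rcons //.
rewrite height_rcons // nth_rcons ltnn eqxx; congr rcons.
by apply/eq_in_map => g; rewrite mem_iota add0n ltnS => /= gk; rewrite height_rcons.
Qed.

(** The old endpoint becomes interior, and an up step flips the sign. An initial up step keeps the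
    exponent [count_mem true s - 1] from being truncated. *)
Lemma path_weight_rcons (s : seq bool) (b : bool) : head false s ->
  path_weight (rcons s b) = path_weight s * (IZR (height s (size s)) * IZR (- step_sign b)).
Proof.
move=> hs; have [s0 c0] : (0 < size s)%N /\ (0 < count_mem true s)%N.
  by case: s hs => [|[]].
rewrite /path_weight size_rcons big_nat_recr //= height_rcons //.
rewrite (eq_big_nat _ _ (F2 := fun k => IZR (height s k))); last first.
  by move=> k /andP[_ /ltnW kl]; rewrite height_rcons.
rewrite -cats1 count_cat /=; case: (count_mem true s) c0 => // c _.
by case: b; rewrite /= ?addn0 ?addn1 !subSS !subn0 /=; ring.
Qed.

Lemma path_sum_step (k : nat) (H : seq Z -> R) :
  \big[Rplus/R0]_(s : k.+2.-tuple bool | head false s) (path_weight s * H (heights s)) =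
  \big[Rplus/R0]_(s : k.+1.-tuple bool | head false s)
     (path_weight s * history_step H (heights s)).
Proof.
rewrite big_mkcond [RHS]big_mkcond /=.
rewrite (big_tuple_rcons _ _
  (fun s => if head false s then path_weight s * H (heights s) else R0)).
apply: eq_bigr => s _.
have hs b : head false (rcons s b) = head false s by case/tupleP: s.
rewrite big_bool !hs; case: ifP => h; last exact: Rplus_0_l.
have lh : last 0%Z (heights s) = height s (size s) by rewrite last_mkseq.
rewrite !path_weight_rcons // !heights_rcons /history_step lh /Z.sub -[(- (1))%Z]/(-1)%Z /=; ring.
Qed.

(** Both sides obey the recursion [history_step], so induction on [k] works with [H] left general.
    At [k = 1] a single partition, with profile (0, 1), faces the single up step. *)
Lemma mobius_sum_by_paths (N k : nat) (H : seq Z -> R) : (0 < k <= N)%N ->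
  \big[Rplus/R0]_(P | partition P (initial N k)) (mobius_weight P * H (profile k P)) =
  \big[Rplus/R0]_(s : k.-tuple bool | head false s) (path_weight s * H (heights s)).
Proof.
case: k => // k; rewrite ltn0Sn; elim: k H => [|k IH] H kN.
  2: by rewrite mobius_profile_step // IH ?path_sum_step // ltnW.
have i0 : initial N 0 = set0 by apply/setP=> j; rewrite !inE.
rewrite (initialS kN) big_partition_insert ?initial_notin // i0.
rewrite (eq_bigl _ _ (@partition_set0 _)) big_pred1_eq.
rewrite setU0 big_set1.
have p0 : partition set0 (set0 : {set 'I_N}) by rewrite partition_set0.
have b0 : (set0 : {set 'I_N}) \in set0 |: set0 by rewrite setU11.
rewrite profile_insert ?i0 //.
have a0 : Ordinal kN \notin (set0 : {set 'I_N}) by rewrite inE.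
have -> : odd_blocks (Ordinal kN |: set0) (part_insert (Ordinal kN) set0 set0) = 1%N.
  have := odd_blocks_insert a0 p0 b0; rewrite cards0 !add0n => ->.
  by rewrite /odd_blocks big_set0.
rewrite /mobius_weight (card_part_insert a0 p0 b0) eqxx (cards0 {set 'I_N}).
rewrite /profile /mkseq /= i0 /odd_blocks big_set0.
rewrite (big_pred1 [tuple true]) /= /path_weight ?big_geq //=.
move=> s /=; case/tupleP: s => b s; rewrite (tuple0 s); case: b => //=.
Qed.

(** * Moments of the Ising measure *)

Definition sgn (b : bool) : R := if b then 1 else -1.

Lemma sgn_pow (b : bool) (m : nat) : sgn b ^ m = if odd m then sgn b else 1.
Proof.
elim: m => //= m ->; case: (odd m) => /=; last by rewrite Rmult_1_r.
by case: b; rewrite /sgn; ring.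
Qed.

Lemma cosh_pos (x : R) : 0 < cosh x.
Proof. by rewrite /cosh; have := exp_pos x; have := exp_pos (- x); lra. Qed.

(** Only the parity of [m] matters: the sum is [2 cosh beta] for even [m] and [2 sinh beta] times
    [sgn c] for odd [m]. *)
Lemma ising_last_site (beta : R) (c : bool) (m : nat) :
  \big[Rplus/R0]_(b : bool) (exp (beta * (sgn c * sgn b)) * sgn b ^ m) =
  2 * cosh beta * tanh beta ^ odd m * sgn c ^ m.
Proof.
have signE := (Rmult_1_l, Rmult_1_r, Ropp_mult_distr_r_reverse, Ropp_mult_distr_l_reverse,
  Ropp_involutive).
have E : cosh beta <> 0 by have := cosh_pos beta; lra.
rewrite big_bool !sgn_pow /tanh; case: (odd m); rewrite /= ?Rmult_1_r.
  have -> : 2 * cosh beta * (sinh beta / cosh beta) = 2 * sinh beta by field.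
  by case: c; rewrite /sinh /sgn !signE; field.
by case: c; rewrite /cosh /sgn !signE; field.
Qed.

Lemma spin_rcons (s : seq bool) (b : bool) (k : nat) : (k < size s)%N ->
  spin (rcons s b) k = spin s k.
Proof. by move=> ks; rewrite /spin nth_rcons ks. Qed.

(* Summing out the last spin multiplies by [2 cosh beta] and moves its exponent
   onto the neighbouring site. *)
Lemma ising_spin_sum (beta : R) (n : nat) (m : nat -> nat) :
  \big[Rplus/R0]_(s : n.+1.-tuple bool)
    (ising_weight beta s * \big[Rmult/R1]_(v < n.+1) spin s v ^ m v) =
  2 * (2 * cosh beta) ^ n *
  ((if odd (\sum_(0 <= u < n.+1) m u) then 0 else 1) *
   \big[Rmult/R1]_(1 <= v < n.+1) tanh beta ^ odd (\sum_(v <= u < n.+1) m u)).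
Proof.
pose F k (s : seq bool) (m : nat -> nat) :=
  exp (beta * \big[Rplus/R0]_(k < k) (spin s k * spin s k.+1)) *
  \big[Rmult/R1]_(v < k.+1) spin s v ^ m v.
transitivity (\big[Rplus/R0]_(s : n.+1.-tuple bool) F n s m); first by [].
elim: n m => [|n IH] m.
  rewrite (big_tuple_rcons _ _ (fun s => F 0%N s m)) (big_pred1 [tuple]); last first.
    by move=> s; rewrite (tuple0 s); apply/esym/eqP.
  rewrite big_bool /F !big_ord0 !big_ord1 big_nat1 big_geq //=.
  rewrite Rmult_0_r exp_0 -[spin [:: true] 0]/(sgn true) -[spin [:: false] 0]/(sgn false) !sgn_pow.
  by case: odd; rewrite /sgn; ring.
(* The exponents left after summing out site [n.+1]: its exponent is added to that of site [n]. *)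
pose m' v := (m v + (v == n) * m n.+1)%N.
rewrite (big_tuple_rcons _ _ (fun s => F n.+1 s m)).
have -> : \big[Rplus/R0]_(t : n.+1.-tuple bool) \big[Rplus/R0]_(x : bool) F n.+1 (rcons t x) m
  = 2 * cosh beta * tanh beta ^ odd (m n.+1) * \big[Rplus/R0]_(t : n.+1.-tuple bool) F n t m'.
  rewrite big_distrr /=; apply: eq_bigr => t _.
  have st : size t = n.+1 by rewrite size_tuple.
  have lastE b : spin (rcons t b) n.+1 = sgn b by rewrite /spin nth_rcons st ltnn eqxx.
  have FE b : F n.+1 (rcons t b) m =
      exp (beta * \big[Rplus/R0]_(k < n) (spin t k * spin t k.+1)) *
      \big[Rmult/R1]_(v < n.+1) spin t v ^ m v *
      (exp (beta * (sgn (nth false t n) * sgn b)) * sgn b ^ m n.+1).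
    rewrite /F big_ord_recr [in X in _ * X]big_ord_recr /= lastE spin_rcons ?st //.
    rewrite Rmult_plus_distr_l exp_plus.
    under eq_bigr => k _ do rewrite !spin_rcons ?st ?ltnS ?(ltnW (ltn_ord k)) //.
    under [in X in _ * X]eq_bigr => k _ do rewrite spin_rcons ?st //.
    rewrite -/(sgn _) /spin -/(sgn _); ring.
  under eq_bigr => b _ do rewrite FE.
  rewrite -big_distrr /= ising_last_site /F.
  have -> : \big[Rmult/R1]_(v < n.+1) spin t v ^ m' v =
     \big[Rmult/R1]_(v < n.+1) spin t v ^ m v * sgn (nth false t n) ^ m n.+1.
    rewrite !big_ord_recr /= {2}/m' eqxx mul1n Rdef_pow_add.
    rewrite -/(sgn _) /spin Rmult_assoc; congr (_ * _).
    by apply: eq_bigr => v _; rewrite /m' (ltn_eqF (ltn_ord v)) addn0.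
  have ac w x y z : w * x * (y * z) = y * (w * (x * z)) by ring.
  exact: ac.
rewrite IH.
(* Tail sums starting at or before site [n] do not see the transfer; the remaining tail, [m n.+1]
   alone, supplies the factor just split off. *)
have sE v : (v <= n)%N -> (\sum_(v <= u < n.+2) m u = \sum_(v <= u < n.+1) m' u)%N.
  move=> vn; rewrite big_nat_recr ?(leqW vn) //= big_nat_recr //= [RHS]big_nat_recr //=.
  rewrite {2}/m' eqxx mul1n addnA; congr (_ + _ + _)%N.
  by apply: eq_big_nat => u /andP[_ un]; rewrite /m' (ltn_eqF un) addn0.
rewrite -sE // [X in _ = _ * (_ * X)]big_nat_recr //= big_nat1.
rewrite (eq_big_nat _ _ (F2 := fun v => tanh beta ^ odd (\sum_(v <= u < n.+2) m u))); last first.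
  by move=> v /andP[_ vn]; rewrite sE.
set c := if _ then _ else _; set y := bigop.body _ _ _; set z := tanh _ ^ _; ring.
Qed.

(** The spin at site [v] occurs once for each [j] in [A] with [i j = v], so the transfer formula
    gives a factor [tanh beta] for each bond with an odd number of indices to its right. The
    normalisation is the case of zero exponents. *)
Lemma ising_E_prod_spin (beta : R) (n : nat) (J : finType) (A : {set J}) (i : J -> nat) :
  (0 < n)%N -> (forall j, (i j < n)%N) ->
  ising_E beta (fun s : n.-tuple bool => \big[Rmult/R1]_(j in A) spin s (i j)) =
  if odd #|A| then 0 else
  \big[Rmult/R1]_(1 <= v < n) tanh beta ^ odd #|A :&: [set j | (i j < v)%N]|.
Proof.
case: n => // n _ iN.
pose m u := (\sum_(j in A) (i j == u))%N.
have cardE (B : {set J}) : (#|A :&: B| = \sum_(j in A) (j \in B))%N.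
  rewrite -sum1_card (eq_bigl (fun j => (j \in A) && (j \in B)) _ (fun j => in_setI j A B)).
  rewrite big_mkcondr.
  by apply: eq_bigr => j _; case: (j \in B).
have sumE v : (\sum_(v <= u < n.+1) m u = \sum_(j in A) (v <= i j))%N.
  rewrite /m exchange_big /=; apply: eq_bigr => j _.
  case: leqP => vi.
    rewrite (bigD1_seq (i j)) /= ?mem_index_iota ?iota_uniq ?vi ?iN //=.
    by rewrite eqxx big1 // => u /negbTE; rewrite eq_sym => ->.
  by rewrite big_nat_cond big1 // => u /andP[/andP[vu _] _]; rewrite (ltn_eqF (leq_trans vi vu)).
have ZE : ising_Z n.+1 beta = 2 * (2 * cosh beta) ^ n.
  have s0 v : (\sum_(v <= u < n.+1) 0 = 0)%N by rewrite big1.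
  transitivity (\big[Rplus/R0]_(s : n.+1.-tuple bool)
      (ising_weight beta s * \big[Rmult/R1]_(v < n.+1) spin s v ^ 0)).
    by apply: eq_bigr => s _; rewrite big1 // Rmult_1_r.
  rewrite (ising_spin_sum _ _ (fun=> 0%N)) s0 big1 => [|v _]; last by rewrite s0.
  by rewrite /=; ring.
rewrite /ising_E ZE.
have -> : \big[Rplus/R0]_(s : n.+1.-tuple bool)
    (ising_weight beta s * \big[Rmult/R1]_(j in A) spin s (i j)) =
   \big[Rplus/R0]_(s : n.+1.-tuple bool)
    (ising_weight beta s * \big[Rmult/R1]_(v < n.+1) spin s v ^ m v).
  apply: eq_bigr => s _; congr (_ * _).
  rewrite (partition_big (fun j => Ordinal (iN j)) predT) //=; apply: eq_bigr => v _.
  rewrite /m (big_morph (pow (spin s v)) (Rdef_pow_add _) erefl) big_mkcondr.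
  by apply: eq_bigr => j _; rewrite -val_eqE /=; case: eqP => [->|] //=; rewrite Rmult_1_r.
rewrite ising_spin_sum.
have X0 : 2 * (2 * cosh beta) ^ n <> 0.
  have ? := cosh_pos beta; have : 0 < (2 * cosh beta) ^ n by apply: pow_lt; lra.
  lra.
rewrite sumE (eq_bigr (fun=> 1%N)) ?sum1_card //.
case: ifP => oA; first by rewrite /Rdiv; ring.
rewrite Rmult_1_l [LHS]/Rdiv Rinv_r_simpl_m //; apply: eq_bigr => v _.
congr (_ ^ nat_of_bool _); rewrite sumE cardE.
(* Since [#|A|] is even, the numbers of indices on the two sides of the bond have the same
   parity. *)
have : (\sum_(j in A) (v <= i j) + \sum_(j in A) (j \in [set j | (i j < v)]) = #|A|)%N.
  rewrite -big_split -sum1_card; apply: eq_bigr => j _.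
  by rewrite inE /= ltnNge; case: leqP.
by move/(congr1 odd); rewrite oddD oA; case: (odd _); case: (odd _).
Qed.

(** * Matching exponents and heights *)

Lemma sum_ltn (M h : nat) : (\sum_(l < M) (l < h) = minn h M)%N.
Proof.
elim: M => [|M IH]; first by rewrite big_ord0 minn0.
rewrite big_ord_recr /= {}IH; case: (ltnP M h) => hM.
  by rewrite (minn_idPr hM) addn1.
by rewrite (minn_idPl (leqW hM)) addn0.
Qed.

(** Expresses a distance as the number of bonds crossed, bond [v] joining sites [v - 1] and [v]. *)
Lemma sum_between (n a b : nat) : (a <= b < n)%N ->
  (\sum_(1 <= v < n) ((a < v) && (v <= b)) = b - a)%N.
Proof.
case: n => [|n] /andP[ab]; rewrite ?ltn0 // ltnS => bn.
rewrite big_add1 big_mkord /=.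
apply/(@addIn (\sum_(v < n) (v < a))%N); rewrite -big_split sum_ltn.
rewrite (minn_idPl (leq_trans ab bn)) subnK // -[RHS](minn_idPl bn) -sum_ltn.
apply: eq_bigr => v _ /=; rewrite ltnS.
by case: ltnP => va; case: ltnP => // bv; have := leq_trans bv ab; rewrite ltnNge va.
Qed.

Section UpsStillOpen.
Variables (N : nat) (h : nat -> nat) (u : nat -> bool).
Hypothesis h0 : h 0 = 0%N.
Hypothesis hS : forall k, (k < N)%N -> if u k then h k.+1 = (h k).+1 else h k = (h k.+1).+1.

(** For an up step [k] this says that it is still unmatched after [g] steps: the path has stayed
    strictly over its starting level. *)
Definition above (k g : nat) : bool := all (fun m => h k < h m)%N (iota k.+1 (g - k)).

Lemma aboveS (k g : nat) : (k <= g)%N -> above k g.+1 = above k g && (h k < h g.+1)%N.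
Proof.
by move=> kg; rewrite /above subSn // -(addn1 (g - k)) iotaD all_cat /= andbT addSn subnKC.
Qed.

(** Each level below the current height carries exactly one open up step: an up step opens the level
    [h g] and keeps the others, a down step closes the top one. *)
Lemma count_open_level (g l : nat) : (g <= N)%N ->
  (\sum_(k < g) [&& u k, above k g & h k == l] = (l < h g))%N.
Proof.
elim: g => [|g IH] gN; first by rewrite big_ord0 h0.
have up_step : (\sum_(k < g) [&& u k, above k g.+1 & h k == l]
    = (l < h g.+1)%N * \sum_(k < g) [&& u k, above k g & h k == l])%N.
  rewrite big_distrr; apply: eq_bigr => k _; rewrite aboveS ?(ltnW (ltn_ord k)) //=.
  case: eqP => [->|]; last by rewrite !andbF muln0.
  by case: (u k); case: (above k g); case: (l < _)%N.
rewrite big_ord_recr /= up_step IH ?(ltnW gN) // /above subSnn /= andbT.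
have := hS gN; case: (u g) => /= ->; last by rewrite addn0 mulnb ltnS; case: ltngtP.
by rewrite !ltnS leqnn /=; case: ltngtP.
Qed.

Lemma height_le (g : nat) : (g <= N)%N -> (h g <= g)%N.
Proof.
elim: g => [|g IH] gN; first by rewrite h0.
have := hS gN; have := IH (ltnW gN); case: (u g) => [hg ->|hg E] //.
by apply: leq_trans (leqW hg); rewrite E ltnW.
Qed.

Lemma count_open (g : nat) : (g <= N)%N -> (\sum_(k < g) (u k && above k g) = h g)%N.
Proof.
(* The height is counted as its number of lower levels; [N.+1] levels suffice because no height
   exceeds [N]. *)
move=> gN; rewrite -[RHS](minn_idPl (leq_trans (height_le gN) (leqW gN))) -sum_ltn.
under [RHS]eq_bigr => l _ do rewrite -count_open_level //.
rewrite exchange_big /=; apply: eq_bigr => k _.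
have hk : (h k < N.+1)%N.
  by rewrite ltnS (leq_trans (height_le _)) ?(leq_trans (ltnW (ltn_ord k))).
rewrite (bigD1 (Ordinal hk)) //= eqxx andbT big1 ?addn0 //.
by move=> l; rewrite -val_eqE /= eq_sym => /negbTE ->; rewrite !andbF.
Qed.

(** Unit steps cannot jump over a level, so a path that never hits [h k] again stays over it. The
    test starts at [k.+2], since the up step already puts [k.+1] one higher. *)
Lemma above_neq (k g : nat) : u k -> (k < N)%N -> (k < g <= N)%N ->
  above k g = all (fun m => h m != h k) (iota k.+2 (g - k.+1)).
Proof.
move=> uk kN /andP[]; elim: g => // g IH; rewrite ltnS leq_eqVlt => /orP[/eqP<- _|kg gN].
  by rewrite /above subSnn subnn /= andbT; have := hS kN; rewrite uk => ->; rewrite ltnSn.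
rewrite aboveS ?(ltnW kg) // subSn // -(addn1 (g - k.+1)) iotaD all_cat /= andbT addSn subnKC //.
rewrite -IH ?(ltnW gN) //; case E: (above k g) => //=.
have hg : (h k < h g)%N.
  by case: (g) kg E => // g' kg; rewrite aboveS // => /andP[].
rewrite ltn_neqAle eq_sym -[RHS]andbT; congr andb.
have := hS gN; case: (u g) => E1; first by rewrite E1 leqW // ltnW.
by rewrite -ltnS -E1.
Qed.
End UpsStillOpen.

Definition nheight (s : seq bool) (k : nat) : nat := Z.to_nat (height s k).

Lemma nheight0 (s : seq bool) : nheight s 0 = 0%N.
Proof. by rewrite /nheight /height take0. Qed.

Definition nonneg_path (s : seq bool) : Prop :=
  forall k, (k <= size s)%N -> (0 <= height s k)%Z.

Lemma nheightS (s : seq bool) : nonneg_path s -> forall k, (k < size s)%N ->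
  if nth false s k then nheight s k.+1 = (nheight s k).+1
  else nheight s k = (nheight s k.+1).+1.
Proof.
move=> s0 k ks; have h1 := s0 _ ks; have h2 := s0 _ (ltnW ks); rewrite /nheight.
by move: h1; rewrite heightS // /step_sign; case: nth => h1; lia.
Qed.

Lemma leq_find (T : Type) (a : pred T) (l : seq T) (d : nat) : (d <= size l)%N ->
  (d <= find a l)%N = all (predC a) (take d l).
Proof.
elim: l d => [|x l IH] [|d] //=; rewrite ltnS => dl.
by case: (a x) => //=; rewrite ltnS IH.
Qed.

(** The partner is the first return to the starting level, so it comes at [g] or later exactly when
    none of the heights up to [g] is a return. *)
Lemma leq_partner (s : seq bool) (k g : nat) : nonneg_path s ->
  nth false s k -> (k < g <= size s)%N ->
  (g <= partner s k)%N = above (nheight s) k g.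
Proof.
move=> s0 uk /andP[kg gs]; have ks := leq_trans kg gs.
rewrite (above_neq (nheightS s0)) ?kg //.
rewrite /partner -leq_subLR leq_find ?size_iota ?leq_sub2r //.
rewrite take_iota (minn_idPl (leq_sub2r _ gs)) -[k.+2]addn0 iotaDl all_map.
apply: eq_in_all => d; rewrite mem_iota add0n => /= dg.
have dg' : (k.+2 + d <= size s)%N.
  by apply: leq_trans gs; rewrite addSn -ltn_subRL.
rewrite addn0; congr (~~ _); rewrite /nheight; have := s0 _ dg'; have := s0 _ (ltnW ks).
by move=> ? ?; apply/idP/eqP => [/Z.eqb_eq ->//|E]; apply/Z.eqb_eq; lia.
Qed.

(** Double counting of pairs and bonds. Here [c v] is the number of indices below [v], and a pair
    spans bond [v] when its up step is open after [c v] steps; the number of such steps is the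
    height there. *)
Lemma pair_exponent_heights (s : seq bool) (n : nat) (i c : nat -> nat) :
  nonneg_path s -> height s (size s) = 0%Z ->
  (forall k, (k < size s)%N -> (i k < n)%N) ->
  (forall v, (c v <= size s)%N) ->
  (forall v k, (k < size s)%N -> (i k < v)%N = (k < c v)%N) ->
  pair_exponent s i = (\sum_(1 <= v < n) nheight s (c v))%N.
Proof.
move=> s0 sN iN cs ci.
(* The path ends at 0, so no up step is still open at the end and every partner is a genuine
   step. *)
have pN (k : nat) : (k < size s)%N -> nth false s k -> (partner s k < size s)%N.
  move=> ks uk; rewrite ltnNge leq_partner ?ks ?leqnn // /above.
  apply/allPn; exists (size s); last by rewrite /nheight sN.
  by rewrite mem_iota ks addSn subnKC ?ltnS ?leqnn ?(ltnW ks).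
have i_mono k j : (k <= j)%N -> (j < size s)%N -> (i k <= i j)%N.
  move=> kj js; have ks := leq_ltn_trans kj js; rewrite -ltnS (ci _ _ ks).
  by apply: leq_ltn_trans kj _; rewrite -(ci _ _ js).
rewrite /pair_exponent.
transitivity (\sum_(k < size s | nth false s k) \sum_(1 <= v < n)
    ((k < c v) && (c v <= partner s k)))%N.
  apply: eq_bigr => k uk; have pk := pN k (ltn_ord k) uk.
  rewrite -(@sum_between n); last first.
    by rewrite iN // i_mono // /partner addSn ltnW // ltnS leq_addr.
  by apply: eq_bigr => v _; rewrite -ci // (leqNgt (c v)) -ci // -leqNgt.
rewrite exchange_big /=; apply: eq_bigr => v _.
rewrite -(count_open (N := size s) (nheight0 s) (nheightS s0)) //.
rewrite (big_ord_widen _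
  (fun k => nat_of_bool (nth false s k && above (nheight s) k (c v))) (cs v)).
rewrite big_mkcond [RHS]big_mkcond /=; apply: eq_bigr => k _.
case uk: (nth _ _ _); last by case: ifP.
by case: ltnP => kc //=; rewrite leq_partner ?kc ?cs.
Qed.

(** * The cumulant as a path sum *)

Lemma heightE (s : seq bool) (k : nat) : (k <= size s)%N ->
  height s k = (2 * Z.of_nat (count_mem true (take k s)) - Z.of_nat k)%Z.
Proof.
elim: k => [|k IH] ks; first by rewrite /height take0.
rewrite heightS // IH ?(ltnW ks) // (take_nth false ks) -cats1 count_cat.
by rewrite /step_sign; case: nth; rewrite ?[count _ [:: _]]/= ?addn1 ?addn0; lia.
Qed.

(** A path that starts upwards with unit steps cannot change sign without visiting 0. *)
Lemma pos_path_of_neq0 (s : seq bool) : head false s ->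
  (forall k, (0 < k < size s)%N -> height s k <> 0%Z) ->
  forall k, (0 < k < size s)%N -> (0 < height s k)%Z.
Proof.
move=> hs nz; elim=> // k IH /andP[_ ks].
have nk := nz k.+1 ks; move: nk; rewrite heightS ?(ltnW ks) //.
case: k IH ks => [|k] IH ks nk.
  by case: s hs {nz IH ks nk} => [|[]].
by have := IH (ltnW ks); move: nk; rewrite /step_sign; case: nth; lia.
Qed.

Lemma dyckstarP (s : seq bool) :
  reflect (height s (size s) = 0%Z /\ forall k, (0 < k < size s)%N -> (0 < height s k)%Z)
    (dyckstar s).
Proof.
apply: (iffP andP) => -[h0 pos]; split; try exact/Z.eqb_eq.
  move=> k /andP[k0 ks]; apply/Z.ltb_lt.
  by have /forallP/(_ (Ordinal ks))/implyP/(_ k0) := pos.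
by apply/forallP=> k; apply/implyP=> k0; apply/Z.ltb_lt; apply: pos; rewrite k0 ltn_ord.
Qed.

(** The product of block moments as a functional of the heights: a nonzero final height means an odd
    block, whose moment vanishes. *)
Definition profile_value (x : R) (n N : nat) (c : nat -> nat) (t : seq Z) : R :=
  if Z.eqb (nth 0%Z t N) 0 then
    \big[Rmult/R1]_(1 <= v < n) x ^ Z.to_nat (nth 0%Z t (c v))
  else 0.

Lemma Rprod_pow (n : nat) (x : R) (F : nat -> nat) :
  \big[Rmult/R1]_(1 <= v < n) x ^ F v = x ^ (\sum_(1 <= v < n) F v).
Proof. by rewrite (big_morph (pow x) (Rdef_pow_add _) erefl). Qed.

Lemma Rprod_eq0 (I : finType) (A : {pred I}) (F : I -> R) (k : I) :
  k \in A -> F k = 0 -> \big[Rmult/R1]_(i in A) F i = 0.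
Proof. by move=> kA F0; rewrite (bigD1 k) //= F0 Rmult_0_l. Qed.

(** With all blocks even, exchanging the products over blocks and bonds collects at bond [v] one [x]
    per block of odd trace, that is, the height at [c v]. *)
Lemma prod_moments (x : R) (n N : nat) (c : nat -> nat) (P : {set {set 'I_N}}) :
  (forall v, (c v <= N)%N) ->
  \big[Rmult/R1]_(A in P) (if odd #|A| then 0 else
     \big[Rmult/R1]_(1 <= v < n) x ^ odd #|A :&: initial N (c v)|) =
  profile_value x n N c (profile N P).
Proof.
move=> cN; have iT : initial N N = setT by apply/setP=> j; rewrite !inE ltn_ord.
have nthE g : (g <= N)%N -> nth 0%Z (profile N P) g = Z.of_nat (odd_blocks (initial N g) P).
  by move=> gN; rewrite nth_mkseq.
rewrite /profile_value nthE // iT.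
have [/existsP[A /andP[AP oA]]|/existsPn noA] := boolP [exists A, (A \in P) && odd #|A|].
  rewrite (Rprod_eq0 AP) ?oA //; case: Z.eqb_spec => // E.
  suff: (0 < odd_blocks setT P)%N by move/ltP; lia.
  by rewrite /odd_blocks (bigD1 A) //= setIT oA.
have -> : odd_blocks setT P = 0%N.
  rewrite /odd_blocks big1 // => A AP; rewrite setIT.
  by have := noA A; rewrite AP /= => /negbTE ->.
rewrite /=.
under eq_bigr => A AP.
  have -> : odd #|A| = false by have := noA A; rewrite AP /= => /negbTE.
  over.
rewrite exchange_big /=; apply: eq_bigr => v _.
by rewrite nthE // Nat2Z.id (big_morph (pow x) (Rdef_pow_add _) erefl).
Qed.

(** A path outside the Dyck class starts downwards, ends away from 0, or returns to 0 inside; the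
    three cases are killed by the head condition, by [profile_value] and by a zero height factor. *)
Lemma path_weight_profile_value (x : R) (n : nat) (i c : nat -> nat) (s : seq bool) :
  (0 < size s)%N ->
  (forall k, (k < size s)%N -> (i k < n)%N) ->
  (forall v, (c v <= size s)%N) ->
  (forall v k, (k < size s)%N -> (i k < v)%N = (k < c v)%N) ->
  (if head false s then
     path_weight s * profile_value x n (size s) c (heights s) else 0) =
  (if dyckstar s then
     (-1) ^ ((size s)./2 - 1) *
     ((\big[Rmult/R1]_(1 <= k < size s) IZR (height s k)) * x ^ pair_exponent s i)
   else 0).
Proof.
move=> s0 iN cs ci.
have nthE g : (g <= size s)%N -> nth 0%Z (heights s) g = height s g.
  by move=> gs; rewrite nth_mkseq.
case: dyckstarP => [[hN pos]|nD].
  have hs : head false s.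
    have : (1 < size s)%N by case: s s0 hN {pos iN cs ci nthE} => [|[] [|b s]].
    by move=> s1; have := pos 1%N s1; case: (s) s0 => [|[] u] // _; rewrite /height /= take0.
  have nn : nonneg_path s.
    move=> k; rewrite leq_eqVlt => /orP[/eqP->|ks]; first by rewrite hN.
    case: k ks => [|k] ks; first by rewrite /height take0.
    by apply: Z.lt_le_incl; apply: pos.
  rewrite hs /profile_value nthE // hN /= (pair_exponent_heights nn hN iN cs ci).
  rewrite -Rprod_pow /path_weight -Rmult_assoc; congr (_ ^ _ * _ * _).
    (* Final height 0 forces as many up steps as down steps, which fixes the sign. *)
    have := heightE (leqnn (size s)); rewrite take_size hN => E.
    have -> : size s = (count_mem true s).*2 by rewrite -addnn -plusE; lia.
    by rewrite doubleK.
  by apply: eq_bigr => v _; rewrite nthE.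
case: ifP => // hs; rewrite /profile_value nthE //.
case: Z.eqb_spec => [hN|_]; last by rewrite Rmult_0_r.
have [/existsP[k /andP[k0 /Z.eqb_eq hk]]|/existsPn nz] :=
    boolP [exists k : 'I_(size s), (0 < k)%N && Z.eqb (height s k) 0].
  rewrite /path_weight (bigD1_seq (k : nat)) ?iota_uniq ?mem_index_iota ?k0 ?ltn_ord //=.
  by rewrite hk; ring.
case: nD; split=> // k; apply: pos_path_of_neq0 => // j /andP[j0 js] hj.
by have := nz (Ordinal js); rewrite /= j0 hj.
Qed.

(* Indices i_1 <= ... <= i_{2r} are given 0-based as i 0 <= ... <= i (2r-1),
   each < n (sites 0..n-1). *)
Theorem theorem5p1 (beta : R) (n r : nat) (i : nat -> nat) :
  0 < beta ->
  (1 <= r)%N ->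
  (forall k, (k < 2 * r)%N -> (i k < n)%N) ->
  (forall k, (k.+1 < 2 * r)%N -> (i k <= i k.+1)%N) ->
  cumulant (fun A : {set 'I_(2 * r)} =>
              ising_E beta (fun sigma : n.-tuple bool =>
                 \big[Rmult/R1]_(j in A) spin sigma (i j)))
  = (-1) ^ (r - 1) *
    \big[Rplus/R0]_(s : (2 * r).-tuple bool | dyckstar s)
       ((\big[Rmult/R1]_(1 <= k < 2 * r) IZR (height s k))
        * tanh beta ^ pair_exponent s i).
Proof.
move=> _ r0 iN iS; set N := (2 * r)%N.
have N0 : (0 < N)%N by rewrite muln_gt0.
have n0 : (0 < n)%N by apply: leq_trans (iN 0%N N0).
(* The number of indices below [v]: as [i] is monotone, these indices form an initial segment. *)
pose c v := find (fun k => v <= i k)%N (iota 0 N).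
have cN v : (c v <= N)%N by rewrite -[X in (_ <= X)%N](size_iota 0 N) find_size.
have i_mono k j : (k <= j)%N -> (j < N)%N -> (i k <= i j)%N.
  elim: j => [|j IH]; first by rewrite leqn0 => /eqP->.
  rewrite leq_eqVlt => /orP[/eqP-> //|kj jN].
  by apply: leq_trans (IH kj (ltnW jN)) (iS _ jN).
have ci v k : (k < N)%N -> (i k < v)%N = (k < c v)%N.
  move=> kN; rewrite /c leq_find ?size_iota // take_iota (minn_idPl kN).
  apply/idP/allP => [ikv j|/(_ k)]; last first.
    by rewrite mem_iota add0n ltnSn /= -ltnNge => ->.
  rewrite mem_iota add0n ltnS /= -ltnNge => jk.
  exact: leq_ltn_trans (i_mono _ _ jk kN) ikv.
have iT : initial N N = setT by apply/setP=> j; rewrite !inE ltn_ord.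
rewrite /cumulant -iT.
under eq_bigr => P _.
  under eq_bigr => A _.
    rewrite ising_E_prod_spin //; last by move=> j; apply: iN.
    have -> : \big[Rmult/R1]_(1 <= v < n)
        tanh beta ^ odd #|A :&: [set j : 'I_N | (i j < v)%N]| =
      \big[Rmult/R1]_(1 <= v < n) tanh beta ^ odd #|A :&: initial N (c v)|.
      apply: eq_bigr => v _; congr (_ ^ odd #|pred_of_set (_ :&: _)|).
      by apply/setP=> j; rewrite !inE ci.
    over.
  rewrite prod_moments // -/(mobius_weight P).
  over.
(* Every summand is now a Möbius weight times a functional of the profile, so the sum passes to
   paths and is compared path by path. *)
rewrite mobius_sum_by_paths ?N0 ?leqnn // big_distrr /=.
rewrite big_mkcond [RHS]big_mkcond; apply: eq_bigr => s _.
have sN : size s = N by rewrite size_tuple.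
have := @path_weight_profile_value (tanh beta) n i c s.
rewrite sN (_ : N./2 = r); last by rewrite /N mul2n doubleK.
by apply.
Qed.
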